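(* For every typing context $\Gamma$, formula $A$ and term $u$ such that $\Gamma\vdash_{\mathtt{NI}^2_{RP}}u:A$, one has $\Gamma\vdash_{\mathtt{NI}^2_{RP}}u\simeq_{\eta\varepsilon}u^{\downarrow^{\varepsilon}}:A$, where $u^{\downarrow^{\varepsilon}}$ is the $\varepsilon$-atomization of $u$.
   Context: Notation for lists: for a finite (possibly empty) list $\mathcal A=\langle a_1,\dots,a_n\rangle$, $\langle A_a\rangle_{a\in\mathcal A}\supset B$ abbreviates $A_{a_1}\supset\dots\supset A_{a_n}\supset B$ (just $B$ if $\mathcal A$ is empty); $\lambda\langle x_a\rangle_{a\in\mathcal A}.t$ abbreviates $\lambda x_{a_1}\dots\lambda x_{a_n}.t$ and $t\langle u_a\rangle_{a\in\mathcal A}$ abbreviates $t\,u_{a_1}\cdots u_{a_n}$. Index sets are omitted when clear. Formulas. $\mathcal L^2$: $A::=X\mid A\supset B\mid\forall X.A$, with $X$ ranging over propositional variables. A universal polynomial formula is one of the form $\forall X.\langle\langle A_{kj}\rangle_{j\in J_k}\supset X\rangle_{k\in\mathcal K}\supset X$, where $\mathcal K$ and all $J_k$ are finite lists and $X$ is not free in any $A_{kj}$. $\mathcal L^2_{RP}$ is the set of $\mathcal L^2$-formulas in which every subformula beginning with $\forall$ is universal polynomial (the $A_{kj}$ being themselves in $\mathcal L^2_{RP}$). System $\mathtt{NI}^2$ (System F over $\mathcal L^2$): terms $t::=x\mid\lambda x.t\mid tu\mid\Lambda X.t\mid tB$, with the usual rules: $\Gamma,x:A\vdash x:A$; from $\Gamma,x:A\vdash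 t:B$ infer $\Gamma\vdash\lambda x.t:A\supset B$; from $\Gamma\vdash t:A\supset B$ and $\Gamma\vdash u:A$ infer $\Gamma\vdash tu:B$; from $\Gamma\vdash t:A$ with $X\notin FV(\Gamma)$ infer $\Gamma\vdash\Lambda X.t:\forall X.A$; from $\Gamma\vdash t:\forall X.A$ infer $\Gamma\vdash tB:A\llbracket B/X\rrbracket$ ($B$ is the witness). $\mathtt{NI}^2_{RP}$ is the restriction of $\mathtt{NI}^2$ to $\mathcal L^2_{RP}$-formulas (in particular witnesses are in $\mathcal L^2_{RP}$). Terms represent natural deduction derivations; the type information of a derivation is regarded as part of the term, though not displayed, and the map below is defined by recursion on typing derivations. Contexts. A term context $\mathtt U$ is a term with a distinguished variable $[\ ]$ (the hole), occurring any finite number of times. $\mathtt U[t]$ is capture-avoiding substitution of $t$ for $[\ ]$; $\mathtt U\{t\}$ is variable-capturing substitution. $\mathtt U:A\vdash^\Gamma B$ means $\Gamma,x:A\vdash\mathtt U[x]:B$. Equational theory. $\Gamma\vdash_{\mathtt{NI}^2_{RP}}t\simeq_{\eta\varepsilon}s:A$ means that $t\simeq s$ is derivable at type $A$ in context $\Gamma$, within $\mathtt{NI}^2_{RP}$, by reflexivity, symmetry, transitivity, congruence and the rules: ($\supset\eta$) $t\simeq\lambda x.tx$ for $t:A\supset B$, $x\notin FV(t)$; ($\forall\eta$) $t\simeq\Lambda X.tX$ for $t:\forall X.A$, $X\notin FV(t)$; ($\varepsilon$) if $\Gamma\vdash t:\forall X.\langle\langle A_{kj}\rangle_{j\in J_k}\supset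 X\rangle_{k\in\mathcal K}\supset X$ (universal polynomial), $\Gamma\vdash u_k:\langle A_{kj}\rangle_{j\in J_k}\supset C$ for all $k\in\mathcal K$, and $\mathtt U:C\vdash^\Gamma D$, then $\mathtt U[\,t\,C\,\langle u_k\rangle_{k}]\simeq t\,D\,\langle\lambda\langle w_j\rangle_{j\in J_k}.\mathtt U[u_k\langle w_j\rangle]\rangle_{k}:D$, with the $w_j$ fresh. Weak expansion contexts. For $B\in\mathcal L^2$, $\mathsf{at}(B)$ is its rightmost variable. The contexts $\mathtt{El}_B$, $\mathtt{In}_B$ are defined with the same fresh variables in both: $\mathtt{El}_Z=\mathtt{In}_Z=[\ ]$ for a variable $Z$; $\mathtt{El}_{C\supset D}=\mathtt{El}_D[[\ ]x]$, $\mathtt{In}_{C\supset D}=\lambda x.\mathtt{In}_D$; $\mathtt{El}_{\forall X.D}=\mathtt{El}_D[[\ ]X]$, $\mathtt{In}_{\forall X.D}=\Lambda X.\mathtt{In}_D$. (If the rightmost variable is bound in $B$, then $\mathsf{at}(B)$ denotes the corresponding type variable used in $\mathtt{El}_B,\mathtt{In}_B$.) $\varepsilon$-atomization. For $u$ typable in $\mathtt{NI}^2_{RP}$: $x^{\downarrow^\varepsilon}=x$; $(\lambda x.t)^{\downarrow^\varepsilon}=\lambda x.t^{\downarrow^\varepsilon}$; $(ts)^{\downarrow^\varepsilon}=t^{\downarrow^\varepsilon}s^{\downarrow^\varepsilon}$; $(\Lambda X.t)^{\downarrow^\varepsilon}=\Lambda X.t^{\downarrow^\varepsilon}$; $(tY)^{\downarrow^\varepsilon}=t^{\downarrow^\varepsilon}Y$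 for $Y$ a variable; and for $B$ not atomic, $t:\forall X.\langle\langle A_{kj}\rangle_{j\in J_k}\supset X\rangle_{k\in\mathcal K}\supset X$ and $Z=\mathsf{at}(B)$: $$(tB)^{\downarrow^\varepsilon}=\lambda\langle y_k\rangle_{k\in\mathcal K}.\,\mathtt{In}_B\big\{\,t^{\downarrow^\varepsilon}Z\,\langle\lambda\langle w_j\rangle_{j\in J_k}.\mathtt{El}_B[y_k\langle w_j\rangle]\rangle_{k\in\mathcal K}\big\}.$$ *)

(* Defs.v *)
(* Type variables and term variables are two independent
   families of de Bruijn indices.  Terms are Church style: the type of a bound
   variable is recorded in the abstraction, so that a context and a term
   determine the typing derivation. *)
From HB Require Import structures.
From mathcomp Require Import all_boot.

Set Implicit Arguments.
Unset Strict Implicit.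
Unset Printing Implicit Defensive.

Inductive form : Type :=
| FVar of nat
| Imp of form & form
| All of form.

Lemma form_eq_dec : comparable form.
Proof. rewrite /comparable /decidable; do 2!decide equality. Defined.

HB.instance Definition _ := hasDecEq.Build form (compareP form_eq_dec).

Definition scons (T : Type) (x : T) (s : nat -> T) (n : nat) : T :=
  if n is m.+1 then s m else x.

Definition upr (r : nat -> nat) : nat -> nat := scons 0 (succn \o r).

Fixpoint fren (r : nat -> nat) (A : form) : form :=
  match A with
  | FVar n => FVar (r n)
  | Imp A B => Imp (fren r A) (fren r B)
  | All A => All (fren (upr r) A)
  end.

Definition fups (s : nat -> form) : nat -> form :=
  scons (FVar 0) (fren succn \o s).

Fixpoint fsubst (s : nat -> form) (A : form) : form :=
  match A with
  | FVar n => s n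
  | Imp A B => Imp (fsubst s A) (fsubst s B)
  | All A => All (fsubst (fups s) A)
  end.

(* A[[B/X]] for the body A of a quantified formula, X being the index 0. *)
Definition finst (A B : form) : form := fsubst (scons B FVar) A.

Definition imps (As : seq form) (B : form) : form := foldr Imp B As.

(* <<A_kj>_j => C>_k => C *)
Definition poly (ks : seq (seq form)) (C : form) : form :=
  imps [seq imps js C | js <- ks] C.

(* forall X. <<A_kj>_j => X>_k => X; the A_kj live outside the scope of X, so
   that the shift expresses that X is not free in them. *)
Definition upoly (ks : seq (seq form)) : form :=
  All (poly (map (map (fren succn)) ks) (FVar 0)).

Fixpoint fargs (A : form) : seq form :=
  if A is Imp A B then A :: fargs B else [::].

(* Left inverse of upoly; meaningless on other formulas. *)
Definition upoly_args (A : form) : seq (seq form) :=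
  if A is All A then [seq [seq fren predn G | G <- fargs F] | F <- fargs A]
  else [::].

Definition is_upoly (A : form) : bool := A == upoly (upoly_args A).

Fixpoint RP (A : form) : bool :=
  match A with
  | FVar _ => true
  | Imp A B => RP A && RP B
  | All B => is_upoly A && RP B
  end.

Lemma fren_cancel r s : cancel s r -> cancel (fren s) (fren r).
Proof.
move=> srK A; elim: A r s srK => [n|A IA B IB|A IA] r s srK /=.
- by rewrite srK.
- by rewrite IA // IB.
- by rewrite IA // => -[|n] //=; rewrite srK.
Qed.

Lemma fargs_imps As n : fargs (imps As (FVar n)) = As.
Proof. by elim: As => //= A As ->. Qed.

Lemma upoly_argsK : cancel upoly upoly_args.
Proof.
move=> ks; rewrite /upoly_args /= fargs_imps -map_comp -map_comp.
rewrite -[RHS]map_id; apply: eq_map => js /=.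
by rewrite fargs_imps mapK //; apply: fren_cancel.
Qed.

Lemma is_upolyP A : reflect (exists ks, A = upoly ks) (is_upoly A).
Proof.
apply: (iffP eqP) => [->|[ks ->]]; last by rewrite upoly_argsK.
by exists (upoly_args A).
Qed.

Lemma RP_imps As B : RP (imps As B) = all RP As && RP B.
Proof. by elim: As => //= A As ->; rewrite andbA. Qed.

Lemma eq_fren r s : r =1 s -> fren r =1 fren s.
Proof.
move=> rs A; elim: A r s rs => [n|A IA B IB|A IA] r s rs /=.
- by rewrite rs.
- by rewrite (IA _ _ rs) (IB _ _ rs).
- by rewrite (IA _ (upr s)) // => -[|n] //=; rewrite rs.
Qed.

Lemma fren_comp r s A : fren r (fren s A) = fren (r \o s) A.
Proof.
elim: A r s => [n|A IA B IB|A IA] r s //=; first by rewrite IA IB.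
by rewrite IA; congr All; apply: eq_fren => -[|n].
Qed.

Lemma fren_imps r As B : fren r (imps As B) = imps (map (fren r) As) (fren r B).
Proof. by elim: As => //= A As ->. Qed.

Lemma fren_upoly r ks : fren r (upoly ks) = upoly (map (map (fren r)) ks).
Proof.
rewrite /upoly /poly /= fren_imps -!map_comp; congr (All (imps _ _)).
apply: eq_map => js /=; rewrite fren_imps -!map_comp; congr imps.
by apply: eq_map => A /=; rewrite !fren_comp.
Qed.

Lemma RP_fren r A : RP A -> RP (fren r A).
Proof.
elim: A r => [n|A IA B IB|A IA] r //.
  by move=> /andP[? ?]; apply/andP; split; [apply: IA|apply: IB].
move=> /andP[/is_upolyP[ks e] ?]; apply/andP; split; last exact: IA.
by apply/is_upolyP; exists (map (map (fren r)) ks); rewrite -fren_upoly -e.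
Qed.

Lemma RP_upoly ks : RP (upoly ks) = all (all RP) ks.
Proof.
have -> : RP (upoly ks) = is_upoly (upoly ks) &&
    RP (poly (map (map (fren succn)) ks) (FVar 0)) by [].
rewrite (introT (is_upolyP _)); last by exists ks.
rewrite /poly RP_imps andbT !all_map; apply: eq_all => js /=.
rewrite RP_imps andbT all_map; apply: eq_all => A /=.
apply/idP/idP => [/(RP_fren predn)|]; last exact: RP_fren.
by rewrite (@fren_cancel predn succn).
Qed.

Inductive term : Type :=
| Var of nat
| Lam of form & term
| App of term & term
| TLam of term
| TApp of term & form.

Fixpoint ren (r : nat -> nat) (t : term) : term :=
  match t with
  | Var n => Var (r n)
  | Lam A t => Lam A (ren (upr r) t)
  | App t u => App (ren r t) (ren r u)
  | TLam t => TLam (ren r t)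
  | TApp t B => TApp (ren r t) B
  end.

(* Renaming of the type variables of a term. *)
Fixpoint tren (r : nat -> nat) (t : term) : term :=
  match t with
  | Var n => Var n
  | Lam A t => Lam (fren r A) (tren r t)
  | App t u => App (tren r t) (tren r u)
  | TLam t => TLam (tren (upr r) t)
  | TApp t B => TApp (tren r t) (fren r B)
  end.

Definition ups (s : nat -> term) : nat -> term := scons (Var 0) (ren succn \o s).

Fixpoint subst (s : nat -> term) (t : term) : term :=
  match t with
  | Var n => s n
  | Lam A t => Lam A (subst (ups s) t)
  | App t u => App (subst s t) (subst s u)
  | TLam t => TLam (subst (tren succn \o s) t)
  | TApp t B => TApp (subst s t) B
  end.

(* lams [:: A_1; ..; A_n] t has n binders, the last one being the index 0 in t;
   vars n lists the corresponding variables, outermost binder first. *)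
Definition lams (As : seq form) (t : term) : term := foldr Lam t As.
Definition apps (t : term) (us : seq term) : term := foldl App t us.
Definition vars (n : nat) : seq term := rev (mkseq Var n).

(* The derivations of NI^2 all of whose formulas, witnesses included, satisfy L;
   NI^2 itself is the case L = predT.  The shift of the context in d_tlam
   expresses that X is not free in it. *)
Inductive derivation (L : pred form) : seq form -> term -> form -> Type :=
| d_var G n A :
    all L (A :: G) -> onth G n = Some A -> derivation L G (Var n) A
| d_lam G A B t :
    all L (Imp A B :: G) ->
    derivation L (A :: G) t B -> derivation L G (Lam A t) (Imp A B)
| d_app G A B t u :
    all L (B :: G) ->
    derivation L G t (Imp A B) -> derivation L G u A ->
    derivation L G (App t u) B
| d_tlam G A t :
    all L (All A :: G) ->
    derivation L (map (fren succn) G) t A -> derivation L G (TLam t) (All A)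
| d_tapp G A t B :
    all L (finst A B :: G) -> L B ->
    derivation L G t (All A) -> derivation L G (TApp t B) (finst A B).

Definition NI2_RP : seq form -> term -> form -> Type := derivation RP.

(* A term context is a term whose index 0 is the hole, so that U : A |-^G B is
   NI2_RP (A :: G) U B. *)
Definition plug (U t : term) : term := subst (scons t Var) U.

(* U transported under n additional term binders. *)
Definition lift_ctx (n : nat) (U : term) : term := ren (upr (addn n)) U.

(* \lambda <w_j>. U[u <w_j>], with w_j of type As_j *)
Definition branch (U : term) (As : seq form) (u : term) : term :=
  let n := size As in
  lams As (plug (lift_ctx n U) (apps (ren (addn n) u) (vars n))).

Inductive eta_eps : seq form -> term -> term -> form -> Prop :=
| e_refl G t A : NI2_RP G t A -> eta_eps G t t A
| e_sym G t s A : eta_eps G t s A -> eta_eps G s t A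
| e_trans G t s r A : eta_eps G t s A -> eta_eps G s r A -> eta_eps G t r A
| e_lam G A B t s :
    eta_eps (A :: G) t s B -> eta_eps G (Lam A t) (Lam A s) (Imp A B)
| e_app G A B t s u v :
    eta_eps G t s (Imp A B) -> eta_eps G u v A ->
    eta_eps G (App t u) (App s v) B
| e_tlam G A t s :
    RP (All A) -> eta_eps (map (fren succn) G) t s A ->
    eta_eps G (TLam t) (TLam s) (All A)
| e_tapp G A t s B :
    RP B -> eta_eps G t s (All A) ->
    eta_eps G (TApp t B) (TApp s B) (finst A B)
| e_eta G A B t :
    NI2_RP G t (Imp A B) ->
    eta_eps G t (Lam A (App (ren succn t) (Var 0))) (Imp A B)
| e_teta G A t :
    NI2_RP G t (All A) ->
    eta_eps G t (TLam (TApp (tren succn t) (FVar 0))) (All A)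
| e_eps G ks t us C D U :
    NI2_RP G t (upoly ks) ->
    size us = size ks ->
    (forall k, k < size ks ->
       NI2_RP G (nth (Var 0) us k) (imps (nth [::] ks k) C)) ->
    NI2_RP (C :: G) U D ->
    eta_eps G (plug U (apps (TApp t C) us))
      (apps (TApp t D) [seq branch U p.1 p.2 | p <- zip ks us]) D.

(* at(B), nlam B, ntlam B: the rightmost variable of B, as seen below all the
   binders of In_B, and the numbers of term and of type binders of In_B. *)
Fixpoint at_ (B : form) : nat :=
  match B with FVar n => n | Imp _ D => at_ D | All D => at_ D end.

Fixpoint nlam (B : form) : nat :=
  match B with FVar _ => 0 | Imp _ D => (nlam D).+1 | All D => nlam D end.

Fixpoint ntlam (B : form) : nat :=
  match B with FVar _ => 0 | Imp _ D => ntlam D | All D => (ntlam D).+1 end.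

(* In_B{t}: the variables bound by In_B are captured, i.e. t lives below the
   binders of In_B. *)
Fixpoint In_ (B : form) (t : term) : term :=
  match B with
  | FVar _ => t
  | Imp C D => Lam C (In_ D t)
  | All D => TLam (In_ D t)
  end.

(* El_B as a term context below the binders of In_B, whose variables it shares:
   the outermost binder of In_(C => D) is the term variable nlam D, the hole
   aside, and that of In_(forall X. D) is the type variable ntlam D.  The
   substitution composes El_D with the context [ ] x, resp. [ ] X. *)
Fixpoint El (B : form) : term :=
  match B with
  | FVar _ => Var 0
  | Imp _ D =>
      subst (scons (App (Var 0) (Var (nlam D).+1)) (Var \o succn)) (El D)
  | All D =>
      subst (scons (TApp (Var 0) (FVar (ntlam D))) (Var \o succn)) (El D)
  end.

(* \lambda <y_k>. In_B{t Z <\lambda <w_j>. El_B[y_k <w_j>]>_k} *)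
Definition eps_expand (ks : seq (seq form)) (t : term) (B : form) : term :=
  let n := size ks in
  let shift_types := fren (addn (ntlam B)) in
  let t' := tren (addn (ntlam B)) (ren (addn (nlam B + n)) t) in
  let ys := map (ren (addn (nlam B))) (vars n) in
  lams [seq imps js B | js <- ks]
    (In_ B (apps (TApp t' (FVar (at_ B)))
       [seq branch (El B) p.1 p.2 | p <- zip (map (map shift_types) ks) ys])).

Fixpoint eps_atomize (G : seq form) (u : term) (A : form) (d : NI2_RP G u A) :
    term :=
  match d with
  | d_var _ n _ _ _ => Var n
  | d_lam _ A _ _ _ d => Lam A (eps_atomize d)
  | d_app _ _ _ _ _ _ d e => App (eps_atomize d) (eps_atomize e)
  | d_tlam _ _ _ _ d => TLam (eps_atomize d)
  | d_tapp _ A _ B _ _ d =>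
      if B is FVar _ then TApp (eps_atomize d) B
      else eps_expand (upoly_args (All A)) (eps_atomize d) B
  end.

(* Main.v *)
Require Import Defs.
From mathcomp Require Import all_boot.

(** The map u |-> u^{down eps} only alters the instances t B with B not atomic,
so that, by induction on the derivation and congruence, everything reduces to
the equivalence
  t B ~ \lambda <y_k>. In_B{t Z <\lambda <w_j>. El_B[y_k <w_j>]>_k}
for a typed t : forall X. <<A_kj>_j => X>_k => X ([eta_eps_expand]).  It is
obtained in three steps.

- t B has type <<A_kj>_j => B>_k => B, hence eta for implications gives
  t B ~ \lambda <y_k>. t B <y_k> ([eta_lams]).
- Every term v of type B satisfies v ~ In_B{El_B[v]}, by induction on B, with
  one eta step for each implication and each quantifier on the right spine of
  B ([eta_In]).  This is applied to v = t B <y_k>.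
- Below the binders of In_B, the context El_B goes from B to the variable
  Z = at(B), so that the rule eps with U = El_B turns El_B[t B <y_k>] into
  t Z <\lambda <w_j>. El_B[y_k <w_j>]>_k.

The induction also needs the atomization of t to be typable; this comes from
the fact that equivalent terms are both typable ([eta_eps_typed]), which rests
on the weakening and substitution lemmas for derivations. *)

Set Implicit Arguments.
Unset Strict Implicit.
Unset Printing Implicit Defensive.

(** * Substitution in formulas *)

Lemma eq_fsubst s s' : s =1 s' -> fsubst s =1 fsubst s'.
Proof.
move=> e A; elim: A s s' e => [n|A IA B IB|A IA] s s' e /=.
- exact: e.
- by rewrite (IA _ _ e) (IB _ _ e).
- by congr All; apply: IA => -[|n] //=; rewrite e.
Qed.

Lemma fsubst_fren s r A : fsubst s (fren r A) = fsubst (s \o r) A.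
Proof.
elim: A s r => [n|A IA B IB|A IA] s r //=; first by rewrite IA IB.
by rewrite IA; congr All; apply: eq_fsubst => -[|n].
Qed.

Lemma fren_fsubst r s A : fren r (fsubst s A) = fsubst (fren r \o s) A.
Proof.
elim: A s r => [n|A IA B IB|A IA] s r //=; first by rewrite IA IB.
rewrite IA; congr All; apply: eq_fsubst => -[|n] //=.
by rewrite !fren_comp; apply: eq_fren.
Qed.

Lemma fsubst_var r A : fsubst (FVar \o r) A = fren r A.
Proof.
elim: A r => [n|A IA B IB|A IA] r //=; first by rewrite IA IB.
by rewrite -IA; congr All; apply: eq_fsubst => -[|n].
Qed.

Lemma fren_id r A : r =1 id -> fren r A = A.
Proof.
elim: A r => [n|A IA B IB|A IA] r e /=; first by rewrite e.
- by rewrite IA // IB.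
- by rewrite IA // => -[|n] //=; rewrite e.
Qed.

Lemma fsubst_imps s As B :
  fsubst s (imps As B) = imps (map (fsubst s) As) (fsubst s B).
Proof. by elim: As => //= A As ->. Qed.

Lemma fsubst_upoly s ks :
  fsubst s (upoly ks) = upoly (map (map (fsubst s)) ks).
Proof.
rewrite /upoly /poly /= fsubst_imps -!map_comp; congr (All (imps _ _)).
apply: eq_map => js /=; rewrite fsubst_imps -!map_comp; congr imps.
by apply: eq_map => A /=; rewrite fsubst_fren fren_fsubst.
Qed.

Lemma RP_fsubst s A : (forall n, RP (s n)) -> RP A -> RP (fsubst s A).
Proof.
elim: A s => [n|A IA B IB|A IA] s Ps //=.
  by move=> /andP[? ?]; apply/andP; split; [apply: IA|apply: IB].
move=> /andP[/is_upolyP[ks e] PA]; apply/andP; split; last first.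
  by apply: IA => // -[|n] //=; apply: RP_fren.
by apply/is_upolyP; exists (map (map (fsubst s)) ks); rewrite -fsubst_upoly -e.
Qed.

Lemma fren_finst r A B :
  fren r (finst A B) = finst (fren (upr r) A) (fren r B).
Proof.
by rewrite /finst fren_fsubst fsubst_fren; apply: eq_fsubst => -[|n].
Qed.

Lemma RP_finst A B : RP (All A) -> RP B -> RP (finst A B).
Proof. by move=> /= /andP[_ PA] PB; apply: RP_fsubst => // -[|n]. Qed.

(** Instantiating a quantified variable by a variable is a renaming. *)
Lemma finst_var r A n :
  finst (fren (upr r) A) (FVar n) = fren (scons n r) A.
Proof.
by rewrite /finst fsubst_fren -fsubst_var; apply: eq_fsubst => -[|m].
Qed.

Lemma finst_upoly A ks B : All A = upoly ks -> finst A B = poly ks B.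
Proof.
move=> [->]; rewrite /finst fsubst_imps -!map_comp; congr imps.
apply: eq_map => js /=; rewrite fsubst_imps -map_comp; congr imps.
rewrite -[RHS]map_id; apply: eq_map => C /=.
by rewrite fsubst_fren fsubst_var fren_id.
Qed.

(** * Renaming and substitution in terms *)

Lemma eq_ren r s : r =1 s -> ren r =1 ren s.
Proof.
move=> e t.
elim: t r s e => [n|A t It|t It u Iu|t It|t It B] r s e /=.
- by rewrite e.
- by rewrite (It _ (upr s)) // => -[|n] //=; rewrite e.
- by rewrite (It _ _ e) (Iu _ _ e).
- by rewrite (It _ _ e).
- by rewrite (It _ _ e).
Qed.

Lemma ren_id r t : r =1 id -> ren r t = t.
Proof.
elim: t r => [n|A t It|t It u Iu|t It|t It B] r e /=.
- by rewrite e.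
- by rewrite It // => -[|n] //=; rewrite e.
- by rewrite It // Iu.
- by rewrite It.
- by rewrite It.
Qed.

Lemma ren_comp r s t : ren r (ren s t) = ren (r \o s) t.
Proof.
elim: t r s => [n|A t It|t It u Iu|t It|t It B] r s //=.
- by rewrite It; congr Lam; apply: eq_ren => -[|n].
- by rewrite It Iu.
- by rewrite It.
- by rewrite It.
Qed.

Lemma eq_tren r s : r =1 s -> tren r =1 tren s.
Proof.
move=> e t.
elim: t r s e => [n|A t It|t It u Iu|t It|t It B] r s e //=.
- by rewrite (It _ _ e) (eq_fren e).
- by rewrite (It _ _ e) (Iu _ _ e).
- by rewrite (It _ (upr s)) // => -[|n] //=; rewrite e.
- by rewrite (It _ _ e) (eq_fren e).
Qed.

Lemma tren_id r t : r =1 id -> tren r t = t.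
Proof.
elim: t r => [n|A t It|t It u Iu|t It|t It B] r e //=.
- by rewrite It // fren_id.
- by rewrite It // Iu.
- by rewrite It // => -[|n] //=; rewrite e.
- by rewrite It // fren_id.
Qed.

Lemma tren_comp r s t : tren r (tren s t) = tren (r \o s) t.
Proof.
elim: t r s => [n|A t It|t It u Iu|t It|t It B] r s //=.
- by rewrite It fren_comp.
- by rewrite It Iu.
- by rewrite It; congr TLam; apply: eq_tren => -[|n].
- by rewrite It fren_comp.
Qed.

Lemma tren_ren r s t : tren r (ren s t) = ren s (tren r t).
Proof.
by elim: t r s => [n|A t It|t It u Iu|t It|t It B] r s //=; rewrite It ?Iu.
Qed.

Lemma eq_subst s s' : s =1 s' -> subst s =1 subst s'.
Proof.
move=> e t.
elim: t s s' e => [n|A t It|t It u Iu|t It|t It B] s s' e /=.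
- exact: e.
- by congr Lam; apply: It => -[|n] //=; rewrite e.
- by rewrite (It _ _ e) (Iu _ _ e).
- by congr TLam; apply: It => n /=; rewrite e.
- by rewrite (It _ _ e).
Qed.

Lemma ren_apps r t us : ren r (apps t us) = apps (ren r t) (map (ren r) us).
Proof. by elim: us t => //= u us IH t; rewrite IH. Qed.

Lemma tren_apps r t us : tren r (apps t us) = apps (tren r t) (map (tren r) us).
Proof. by elim: us t => //= u us IH t; rewrite IH. Qed.

Lemma size_vars n : size (vars n) = n.
Proof. by rewrite size_rev size_mkseq. Qed.

Lemma varsS n : vars n.+1 = Var n :: vars n.
Proof. by rewrite /vars mkseqS rev_rcons. Qed.

Lemma tren_vars r s n :
  map (tren r) (map (ren s) (vars n)) = map (ren s) (vars n).
Proof. by elim: n => // n IH; rewrite varsS /= IH. Qed.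

(** * Structural properties of derivations *)

(** The context and the type of a typable term are in L^2_RP; this lets the side
conditions of the typing rules be recovered from the premises. *)
Lemma NI2_RP_all G t A : NI2_RP G t A -> RP A /\ all RP G.
Proof.
by case=> {G t A} [G n A /andP[]|G A B t /andP[]|G A B t u /andP[]
  |G A t /andP[]|G A t B /andP[]].
Qed.

Lemma NI2_RP_lam G A B t :
  NI2_RP (A :: G) t B -> NI2_RP G (Lam A t) (Imp A B).
Proof.
by move=> d; case: (NI2_RP_all d) => /= PB /andP[PA PG]; apply: d_lam;
  rewrite //= PA PB.
Qed.

Lemma NI2_RP_app G A B t u :
  NI2_RP G t (Imp A B) -> NI2_RP G u A -> NI2_RP G (App t u) B.
Proof.
move=> dt; apply: (d_app _ dt).
by case: (NI2_RP_all dt) => /= /andP[_ ->] ->.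
Qed.

Lemma NI2_RP_tapp G A t B :
  RP B -> NI2_RP G t (All A) -> NI2_RP G (TApp t B) (finst A B).
Proof.
move=> PB dt; apply: d_tapp => //.
by have [PA PG] := NI2_RP_all dt; apply/andP; split=> //; apply: RP_finst.
Qed.

Lemma all_RP_shift r G : all RP G -> all RP (map (fren r) G).
Proof. by elim: G => //= A G IH /andP[? ?]; rewrite RP_fren // IH. Qed.

Lemma onth_shift r G n A :
  onth (map (fren r) G) n = Some A ->
  {A' | onth G n = Some A' & A = fren r A'}.
Proof. by rewrite onth_map; case: (onth G n) => //= A' [<-]; exists A'. Qed.

Lemma NI2_RP_var G n A : all RP G -> onth G n = Some A -> NI2_RP G (Var n) A.
Proof.
move=> PG e; apply: d_var => //; apply/andP; split=> //.
by elim: G n PG e => [|B G IH] [|n] //= /andP[PB PG]; [case=> <-|apply: IH].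
Qed.

Lemma NI2_RP_ren r G G' t A :
    all RP G' ->
    (forall n B, onth G n = Some B -> onth G' (r n) = Some B) ->
  NI2_RP G t A -> NI2_RP G' (ren r t) A.
Proof.
move=> PG' rG d; elim: d r G' PG' rG => {G t A} /=.
- move=> G n A /= /andP[PA _] e r G' PG' rG.
  by apply: d_var; [rewrite /= PA|apply: rG].
- move=> G A B t PG dt IH r G' PG' rG; apply: NI2_RP_lam; apply: IH.
    by move: PG => /= /andP[/andP[-> _] _].
  by move=> [|n] C //=; apply: rG.
- move=> G A B t u PG dt It du Iu r G' PG' rG.
  by apply: NI2_RP_app; [apply: It|apply: Iu].
- move=> G A t /andP[PA _] dt IH r G' PG' rG.
  apply: d_tlam; first exact/andP.
  apply: IH; first exact: all_RP_shift.
  by move=> n B /onth_shift[B' e ->]; rewrite onth_map (rG _ _ e).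
- by move=> G A t B PG PB dt IH r G' PG' rG; apply: NI2_RP_tapp => //; apply: IH.
Qed.

Lemma NI2_RP_tren r G t A :
  NI2_RP G t A -> NI2_RP (map (fren r) G) (tren r t) (fren r A).
Proof.
move=> d; elim: d r => {G t A} /=.
- move=> G n A PG e r; apply: d_var; first exact: (@all_RP_shift r (_ :: _) PG).
  by rewrite onth_map e.
- by move=> G A B t PG dt IH r; apply: NI2_RP_lam; apply: IH.
- by move=> G A B t u PG dt It du Iu r; apply: NI2_RP_app; [apply: It|apply: Iu].
- move=> G A t PG dt IH r.
  apply: d_tlam; first exact: (@all_RP_shift r (All A :: G) PG).
  move: (IH (upr r)); rewrite -!map_comp; congr (NI2_RP _ _ _).
  by apply: eq_map => B /=; rewrite !fren_comp; apply: eq_fren.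
- move=> G A t B PG PB dt IH r; rewrite fren_finst.
  by apply: NI2_RP_tapp; [apply: RP_fren|apply: IH].
Qed.

Lemma NI2_RP_weaken G A t B :
  RP A -> NI2_RP G t B -> NI2_RP (A :: G) (ren succn t) B.
Proof.
move=> PA d; apply: NI2_RP_ren (d) => //.
by case: (NI2_RP_all d) => _ /= ->; rewrite PA.
Qed.

Lemma NI2_RP_subst s G G' t A :
    all RP G' ->
    (forall n B, onth G n = Some B -> NI2_RP G' (s n) B) ->
  NI2_RP G t A -> NI2_RP G' (subst s t) A.
Proof.
move=> PG' sG d; elim: d s G' PG' sG => {G t A} /=.
- by move=> G n A _ e s G' PG' sG; apply: sG.
- move=> G A B t PG dt IH s G' PG' sG.
  have PA : RP A by move: PG => /= /andP[/andP[-> _] _].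
  apply: NI2_RP_lam; apply: IH; first by rewrite /= PA.
  case=> [|n] C /= e; last by apply: NI2_RP_weaken => //; apply: sG.
  by case: e => <-; apply: NI2_RP_var => //=; rewrite PA.
- move=> G A B t u PG dt It du Iu s G' PG' sG.
  by apply: NI2_RP_app; [apply: It|apply: Iu].
- move=> G A t /andP[PA _] dt IH s G' PG' sG.
  apply: d_tlam; first exact/andP.
  apply: IH; first exact: all_RP_shift.
  by move=> n B /onth_shift[B' e ->]; apply: NI2_RP_tren; apply: sG.
- by move=> G A t B PG PB dt IH s G' PG' sG; apply: NI2_RP_tapp => //; apply: IH.
Qed.

Lemma NI2_RP_plug G C U t D :
  NI2_RP (C :: G) U D -> NI2_RP G t C -> NI2_RP G (plug U t) D.
Proof.
move=> dU dt; have [_ PG] := NI2_RP_all dt.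
apply: NI2_RP_subst dU => // -[|n] B /= e; first by case: e => <-.
exact: NI2_RP_var.
Qed.

(** Typing of the eta-expansion of a term of universal type. *)
Lemma NI2_RP_teta G t A :
  NI2_RP G t (All A) ->
  NI2_RP (map (fren succn) G) (TApp (tren succn t) (FVar 0)) A.
Proof.
move=> dt; have := NI2_RP_tapp (isT : RP (FVar 0)) (NI2_RP_tren succn dt).
by rewrite finst_var fren_id // => -[].
Qed.

(** * Iterated abstractions and applications *)

Lemma onth_catrev (T : Type) (s t : seq T) n :
  onth (catrev s t) (size s + n) = onth t n.
Proof.
by rewrite catrevE onth_cat size_rev ltnNge leq_addr /= addKn.
Qed.

Lemma all_RP_catrev As G : all RP (catrev As G) = all RP As && all RP G.
Proof. by rewrite catrevE all_cat all_rev. Qed.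

Lemma NI2_RP_lams G As t B :
  NI2_RP (catrev As G) t B -> NI2_RP G (lams As t) (imps As B).
Proof.
by elim: As G => //= A As IH G d; apply: NI2_RP_lam; apply: IH.
Qed.

Lemma NI2_RP_apps G t us As B :
    NI2_RP G t (imps As B) -> size us = size As ->
    (forall k, k < size As ->
       NI2_RP G (nth (Var 0) us k) (nth (FVar 0) As k)) ->
  NI2_RP G (apps t us) B.
Proof.
elim: us As t => [|u us IH] [|A As] t //= dt [e] dus.
apply: (IH As) => // [|k lt_k]; last exact: (dus k.+1).
exact: NI2_RP_app dt (dus 0 _).
Qed.

(** Renaming by [addn (size As)] weakens a term by the binders of
[lams As]. *)
Lemma NI2_RP_weakens G As t B :
  all RP As -> NI2_RP G t B ->
  NI2_RP (catrev As G) (ren (addn (size As)) t) B.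
Proof.
move=> PAs d; apply: NI2_RP_ren (d) => [|n C]; last by rewrite onth_catrev.
by rewrite all_RP_catrev PAs; case: (NI2_RP_all d).
Qed.

Lemma NI2_RP_vars G As k :
    all RP As -> all RP G -> k < size As ->
  NI2_RP (catrev As G) (nth (Var 0) (vars (size As)) k) (nth (FVar 0) As k).
Proof.
move=> PAs PG lt_k.
(* The k-th variable, counted from the outermost binder, has the index
   size As - k.+1. *)
have lt_r : size As - k.+1 < size As by rewrite ltn_subrL (leq_trans _ lt_k).
rewrite nth_rev size_mkseq // nth_mkseq //; apply: NI2_RP_var.
  by rewrite all_RP_catrev PAs.
rewrite catrevE onth_cat size_rev lt_r.
move: (odflt_onth (FVar 0) (rev As) (size As - k.+1)).
rewrite nth_rev // subnSK // subKn ?(ltnW lt_k) //.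
move: (onthTE (rev As) (size As - k.+1)); rewrite size_rev lt_r.
by case: onth => //= A _ ->.
Qed.

Lemma NI2_RP_branch G U As u C D :
    all RP As -> NI2_RP G u (imps As C) -> NI2_RP (C :: G) U D ->
  NI2_RP G (branch U As u) (imps As D).
Proof.
move=> PAs du dU; have [_ /= /andP[PC PG]] := NI2_RP_all dU.
apply: NI2_RP_lams; apply: (@NI2_RP_plug _ C).
  apply: NI2_RP_ren dU => [|[|n] B] //=; last by rewrite onth_catrev.
  by rewrite PC all_RP_catrev PAs.
apply: (NI2_RP_apps (As := As)); rewrite ?size_vars //.
  exact: NI2_RP_weakens.
by move=> k; apply: NI2_RP_vars.
Qed.

Lemma NI2_RP_inst G ks t C :
  RP C -> NI2_RP G t (upoly ks) -> NI2_RP G (TApp t C) (poly ks C).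
Proof.
move=> PC dt; rewrite -(finst_upoly C (erefl (upoly ks))).
exact: NI2_RP_tapp.
Qed.

(** * Equivalence of terms *)

(** Both sides of an equivalence are typable; the main case is the rule eps,
which needs the typing of [plug] and [branch]. *)
Lemma eta_eps_typed G t s A :
  eta_eps G t s A -> inhabited (NI2_RP G t A) /\ inhabited (NI2_RP G s A).
Proof.
elim=> {G t s A}.
- by move=> G t A d; split.
- by move=> G t s A _ [? ?].
- by move=> G t s r A _ [? _] _ [_ ?].
- move=> G A B t s _ [[dt] [ds]].
  by split; constructor; apply: NI2_RP_lam.
- move=> G A B t s u v _ [[dt] [ds]] _ [[du] [dv]].
  by split; constructor; [apply: NI2_RP_app dt du|apply: NI2_RP_app ds dv].
- move=> G A t s PA _ [[dt] [ds]].
  have PG : all RP G.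
    case: (NI2_RP_all dt) => _; rewrite all_map; apply: sub_all.
    by move=> B /= /(RP_fren predn); rewrite (@fren_cancel predn succn).
  by split; constructor; apply: d_tlam => //; apply/andP.
- move=> G A t s B PB _ [[dt] [ds]].
  by split; constructor; apply: NI2_RP_tapp.
- move=> G A B t dt; split; constructor=> //.
  have [/= /andP[PA _] PG] := NI2_RP_all dt.
  apply: NI2_RP_lam; apply: NI2_RP_app; first exact: NI2_RP_weaken dt.
  by apply: NI2_RP_var => //=; rewrite PA.
- move=> G A t dt; split; constructor=> //.
  apply: d_tlam; first by apply/andP; apply: NI2_RP_all dt.
  exact: NI2_RP_teta.
- move=> G ks t us C D U dt e dus dU.
  have [PD /= /andP[PC PG]] := NI2_RP_all dU.
  have Pks : all (all RP) ks.
    by have [] := NI2_RP_all dt; rewrite RP_upoly.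
  split; constructor.
    apply: NI2_RP_plug dU _.
    apply: NI2_RP_apps (NI2_RP_inst PC dt) _ _; first by rewrite size_map.
    move=> k; rewrite size_map => lt_k.
    by rewrite (nth_map [::]) //; apply: dus.
  apply: NI2_RP_apps (NI2_RP_inst PD dt) _ _.
    by rewrite !size_map size_zip e minnn.
  move=> k; rewrite size_map => lt_k.
  rewrite !(nth_map [::]) // (nth_map ([::], Var 0)).
    rewrite nth_zip //=; apply: NI2_RP_branch (dus k lt_k) dU.
    exact: (allP Pks) (mem_nth _ lt_k).
  by rewrite size_zip e minnn.
Qed.

Lemma eta_eps_lams G As t s B :
  eta_eps (catrev As G) t s B -> eta_eps G (lams As t) (lams As s) (imps As B).
Proof. by elim: As G => //= A As IH G h; apply: e_lam; apply: IH. Qed.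

(** The eta-expansion t ~ \lambda <x_i>. t <x_i>. *)
Lemma eta_lams G As t B :
    NI2_RP G t (imps As B) ->
  eta_eps G t (lams As (apps (ren (addn (size As)) t) (vars (size As))))
    (imps As B).
Proof.
elim: As G t => [|A As IH] G t dt.
  by rewrite /= ren_id //; apply: e_refl.
apply: e_trans (e_eta dt) _; rewrite /=; apply: e_lam.
have [/= /andP[PA _] PG] := NI2_RP_all dt.
have d : NI2_RP (A :: G) (App (ren succn t) (Var 0)) (imps As B).
  apply: NI2_RP_app; first exact: NI2_RP_weaken dt.
  by apply: NI2_RP_var => //=; rewrite PA.
move: (IH _ _ d); rewrite varsS /= ren_comp addn0.
by rewrite (@eq_ren (addn (size As) \o succn) (addn (size As).+1)) // => n /=;
  rewrite addnS.
Qed.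

(** * Weak expansion contexts *)

(** The context of a term below the binders of In_B, for In_B placed in the
context [G]. *)
Fixpoint In_ctx (G : seq form) (B : form) : seq form :=
  match B with
  | FVar _ => G
  | Imp C D => In_ctx (C :: G) D
  | All D => In_ctx (map (fren succn) G) D
  end.

(** [In_ren B t] is [t] transported below the binders of In_B. *)
Definition In_ren (B : form) (t : term) : term :=
  tren (addn (ntlam B)) (ren (addn (nlam B)) t).

Lemma In_ren_Imp C D t : In_ren (Imp C D) t = In_ren D (ren succn t).
Proof.
by rewrite /In_ren ren_comp; congr tren; apply: eq_ren => n /=; rewrite addnS.
Qed.

Lemma In_ren_All D t : In_ren (All D) t = In_ren D (tren succn t).
Proof.
rewrite /In_ren -tren_ren tren_comp; apply: eq_tren => n /=.
by rewrite addnS.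
Qed.

Lemma NI2_RP_In_ren G B t A :
    RP B -> NI2_RP G t A ->
  NI2_RP (In_ctx G B) (In_ren B t) (fren (addn (ntlam B)) A).
Proof.
elim: B G t A => [n|C IC D ID|D ID] G t A PB dt.
- by rewrite /In_ren fren_id // ren_id // tren_id.
- rewrite In_ren_Imp; move: PB => /= /andP[PC PD].
  by apply: ID => //; apply: NI2_RP_weaken.
- rewrite In_ren_All; move: PB => /= /andP[_ PD].
  move: (ID _ _ _ PD (NI2_RP_tren succn dt)); rewrite fren_comp.
  by rewrite (@eq_fren (addn (ntlam D) \o succn) (addn (ntlam D).+1)) // => n /=;
    rewrite addnS.
Qed.

(** El_B takes the formula [B], weakened by the type binders of In_B, to the
variable at(B), in the context below the binders of In_B. *)
Lemma NI2_RP_El G B :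
    RP B -> all RP G ->
  NI2_RP (fren (addn (ntlam B)) B :: In_ctx G B) (El B) (FVar (at_ B)).
Proof.
elim: B G => [n|C IC D ID|D ID] G PB PG.
- exact: NI2_RP_var.
- move: PB => /= /andP[PC PD].
  have PCG : all RP (C :: G) by rewrite /= PC.
  have dx := NI2_RP_In_ren PD (NI2_RP_var PCG (erefl (onth (C :: G) 0))).
  have [PC' PG'] := NI2_RP_all dx.
  have PI : RP (Imp (fren (addn (ntlam D)) C) (fren (addn (ntlam D)) D)).
    by rewrite /= !RP_fren.
  apply: NI2_RP_subst (ID (C :: G) PD PCG) => [|[|n] A e].
  + exact/andP.
  + case: e => <- /=; apply: (@NI2_RP_app _ (fren (addn (ntlam D)) C)).
      by apply: NI2_RP_var => //; apply/andP.
    by move: (NI2_RP_weaken PI dx); rewrite /In_ren /= addn0.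
  + by apply: NI2_RP_var => //; apply/andP.
- move: (PB) => /= /andP[_ PD].
  have PG1 : all RP (map (fren succn) G) by apply: all_RP_shift.
  have [_ /= /andP[_ PG']] := NI2_RP_all (ID _ PD PG1).
  have PA : RP (fren (addn (ntlam D).+1) (All D)) by apply: RP_fren.
  apply: NI2_RP_subst (ID _ PD PG1) => [|[|n] A e].
  + exact/andP.
  + case: e => <- /=.
    set G' := _ :: _; have PG'' : all RP G' by apply/andP.
    have d0 : NI2_RP G' (Var 0) (fren (addn (ntlam D).+1) (All D)).
      exact: NI2_RP_var.
    (* below its own binder, the bound variable of forall X. D is the type
       variable ntlam D *)
    move: (NI2_RP_tapp (isT : RP (FVar (ntlam D))) d0); rewrite finst_var.
    by rewrite (@eq_fren _ (addn (ntlam D))) // => -[|n] /=;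
      rewrite ?addn0 ?addnS.
  + by apply: NI2_RP_var => //; apply/andP.
Qed.

Lemma eta_eps_In G B t s :
    RP B -> eta_eps (In_ctx G B) t s (FVar (at_ B)) ->
  eta_eps G (In_ B t) (In_ B s) B.
Proof.
elim: B G => [n|C IC D ID|D ID] G //.
  by move=> /= /andP[_ PD] h; apply: e_lam; apply: ID.
move=> PB h; apply: e_tlam => //.
by apply: ID => //; move: PB => /= /andP[].
Qed.

(** As El_B has no binders, substitutions into it compose without any
commutation of substitutions with renamings. *)
Lemma subst_El s s' B :
  subst s (subst s' (El B)) = subst (subst s \o s') (El B).
Proof.
elim: B s s' => [n|C _ D ID|D ID] s s' //=;
  by rewrite !ID; apply: eq_subst => -[|n] /=; rewrite ?ID.
Qed.

Lemma plug_El_Imp C D t :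
  plug (El (Imp C D)) t = plug (El D) (App t (Var (nlam D))).
Proof. by rewrite /plug /= subst_El; apply: eq_subst => -[|n]. Qed.

Lemma plug_El_All D t :
  plug (El (All D)) t = plug (El D) (TApp t (FVar (ntlam D))).
Proof. by rewrite /plug /= subst_El; apply: eq_subst => -[|n]. Qed.

(** The eta-expansion v ~ In_B{El_B[v]}. *)
Lemma eta_In G B t :
  NI2_RP G t B -> eta_eps G t (In_ B (plug (El B) (In_ren B t))) B.
Proof.
elim: B G t => [n|C IC D ID|D ID] G t dt.
- by rewrite /In_ren /plug /= ren_id // tren_id //; apply: e_refl.
- apply: e_trans (e_eta dt) _; rewrite plug_El_Imp In_ren_Imp /=; apply: e_lam.
  have [/= /andP[PC _] PG] := NI2_RP_all dt.
  have d : NI2_RP (C :: G) (App (ren succn t) (Var 0)) D.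
    apply: NI2_RP_app; first exact: NI2_RP_weaken dt.
    by apply: NI2_RP_var => //=; rewrite PC.
  by move: (ID _ _ d); rewrite /In_ren /= addn0.
- apply: e_trans (e_teta dt) _; rewrite plug_El_All In_ren_All /=.
  apply: e_tlam; first by case: (NI2_RP_all dt).
  by move: (ID _ _ (NI2_RP_teta dt)); rewrite /In_ren /= addn0.
Qed.

(** * Atomization of one instance *)

(** The equivalence of t B with its atomization.  The formula [B] may be atomic:
both contexts In_B and El_B are then trivial. *)
Lemma eta_eps_expand G ks t B :
    NI2_RP G t (upoly ks) -> RP B ->
  eta_eps G (TApp t B) (eps_expand ks t B) (poly ks B).
Proof.
move=> dt PB; have [Pks PG] := NI2_RP_all dt; rewrite RP_upoly in Pks.
apply: e_trans (eta_lams (NI2_RP_inst PB dt)) _.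
(* Ys lists the types of the variables y_k. *)
set Ys := [seq imps js B | js <- ks].
have sYs : size Ys = size ks by rewrite size_map.
have PYs : all RP Ys.
  by rewrite all_map; apply: sub_all Pks => js /= Pjs; rewrite RP_imps Pjs.
apply: eta_eps_lams; rewrite sYs /=.
have dt' : NI2_RP (catrev Ys G) (ren (addn (size ks)) t) (upoly ks).
  by rewrite -sYs; apply: NI2_RP_weakens.
have dys k : k < size ks ->
    NI2_RP (catrev Ys G) (nth (Var 0) (vars (size ks)) k) (nth (FVar 0) Ys k).
  by rewrite -sYs; apply: NI2_RP_vars.
have dv : NI2_RP (catrev Ys G)
    (apps (TApp (ren (addn (size ks)) t) B) (vars (size ks))) B.
  by apply: NI2_RP_apps (NI2_RP_inst PB dt') _ _; rewrite ?size_vars sYs.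
apply: e_trans (eta_In dv) _; apply: eta_eps_In => //.
rewrite /In_ren ren_apps tren_apps tren_vars /=.
have dt'' := NI2_RP_In_ren PB dt'; rewrite fren_upoly /In_ren ren_comp in dt''.
rewrite ren_comp (@eq_ren _ (addn (nlam B + size ks))) in dt'' *; last first.
  by move=> n /=; rewrite addnA.
(* The rule eps with U = El_B, in the context below all the binders. *)
apply: e_eps dt'' _ _ _.
- by rewrite !size_map size_vars.
- move=> k; rewrite size_map => lt_k.
  have := NI2_RP_In_ren PB (dys k lt_k).
  rewrite -(tren_vars (addn (ntlam B))).
  rewrite !(nth_map (Var 0)) ?size_map ?size_vars //.
  by rewrite !(nth_map [::]) // fren_imps.
- by apply: NI2_RP_El => //; rewrite all_RP_catrev PYs.
Qed.

Theorem proposition15 (G : seq form) (A : form) (u : term)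
    (d : NI2_RP G u A) :
  eta_eps G u (eps_atomize d) A.
Proof.
elim: d => {G A u} /=.
- by move=> G n A PG e; apply: e_refl; apply: d_var.
- by move=> G A B t _ dt IH; apply: e_lam.
- by move=> G A B t u _ dt It du Iu; apply: e_app It Iu.
- by move=> G A t /andP[PA _] dt IH; apply: e_tlam.
- move=> G A t B _ PB dt IH.
  (* All A is a universal polynomial, as a formula of L^2_RP. *)
  have E : All A = upoly (upoly_args (All A)).
    by have [/= /andP[/eqP]] := NI2_RP_all dt.
  have h : eta_eps G (TApp t B)
      (eps_expand (upoly_args (All A)) (eps_atomize dt) B) (finst A B).
    apply: e_trans (e_tapp PB IH) _; rewrite (finst_upoly B E).
    have [_ [d]] := eta_eps_typed IH.
    by apply: eta_eps_expand => //; rewrite -E.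
  by case: B PB h => // n PB _; apply: e_tapp.
Qed.
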